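(* Let $G_{m,n}=P_m\,\Box\,P_n$ be the grid graph. If $m,n\ge 3$, then \begin{align*} SWW_3(G_{m,n})=\frac{1}{360}\big(&9m^5n^3+15m^4n^4+9m^3n^5+15m^4n^3+15m^3n^4-30m^4n^2-50m^3n^3-30m^2n^4\\ &+26m^3n-45m^3n^2-45m^2n^3+45m^2n^2+26mn^3+30m^2n+30mn^2-20mn\big). \end{align*} Moreover, for every $n\ge 3$, $$SWW_3(G_{2,n})=\frac{1}{15}\left(3n^5+10n^4-25n^2+12n\right).$$
   Context: $P_k$ is the path on $k$ vertices and $\Box$ is the Cartesian product of graphs. For nonempty $S\subseteq V(G)$, the Steiner distance $d(S)$ is the minimum number of edges of a connected subgraph of $G$ whose vertex set contains $S$, and $SWW_3(G)=\frac12\sum_{S\subseteq V(G),|S|=3}d(S)+\frac12\sum_{S\subseteq V(G),|S|=3}d(S)^2$. *)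

(* Defs.v *)
From HB Require Import structures.
From mathcomp Require Import all_boot all_order all_algebra.

Set Implicit Arguments.
Unset Strict Implicit.
Unset Printing Implicit Defensive.

Import Order.TTheory GRing.Theory Num.Theory.

Record sgraph := SGraph {
  vertex :> finType;
  adj : rel vertex;
  adj_sym : symmetric adj;
  adj_irr : irreflexive adj }.

Section PathGraph.
Variable k : nat.

Definition path_adj : rel 'I_k := fun i j => (i.+1 == j) || (j.+1 == i).

Lemma path_adj_sym : symmetric path_adj.
Proof. by move=> i j; rewrite /path_adj orbC. Qed.

Lemma path_adj_irr : irreflexive path_adj.
Proof. by move=> i; rewrite /path_adj orbb; apply/negbTE; rewrite neq_ltn ltnSn orbT. Qed.

Definition path_graph : sgraph := SGraph path_adj_sym path_adj_irr.
End PathGraph.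

Section CartesianProduct.
Variables G H : sgraph.

Definition cart_adj : rel (G * H) := fun u v =>
  ((u.1 == v.1) && adj u.2 v.2) || (adj u.1 v.1 && (u.2 == v.2)).

Lemma cart_adj_sym : symmetric cart_adj.
Proof.
move=> u v; rewrite /cart_adj (eq_sym u.1) (eq_sym u.2).
by rewrite (adj_sym u.1) (adj_sym u.2).
Qed.

Lemma cart_adj_irr : irreflexive cart_adj.
Proof. by move=> u; rewrite /cart_adj !adj_irr andbF. Qed.

Definition cart_prod : sgraph := SGraph cart_adj_sym cart_adj_irr.
End CartesianProduct.

Section SteinerDistance.
Variable G : sgraph.

Definition edges : {set {set G}} :=
  [set f | [exists x : G, exists y : G, adj x y && (f == [set x; y])]].

(* A candidate subgraph is a pair (W, F) of a vertex set and an edge set. *)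
Definition is_subgraph (K : {set G} * {set {set G}}) : bool :=
  [forall f in K.2, (f \in edges) && (f \subset K.1)].

Definition is_connected (K : {set G} * {set {set G}}) : bool :=
  (K.1 != set0) &&
  [forall x in K.1, forall y in K.1,
     connect (fun u v : G => [set u; v] \in K.2) x y].

Definition connects (S : {set G}) (K : {set G} * {set {set G}}) : bool :=
  [&& is_subgraph K, is_connected K & S \subset K.1].

(* If no connected subgraph contains S (impossible in a nonempty connected
   graph), the arg min falls back on G itself and the value is irrelevant. *)
Definition steiner_dist (S : {set G}) : nat :=
  #|[arg min_(K < ([set: G], edges) | connects S K) #|K.2| ].2|.

Local Open Scope ring_scope.

Definition SWW (k : nat) : rat :=
  1 / 2 * (\sum_(S : {set G} | #|S| == k) (steiner_dist S)%:R)
  + 1 / 2 * (\sum_(S : {set G} | #|S| == k) (steiner_dist S)%:R ^+ 2).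

End SteinerDistance.

Definition grid (m n : nat) : sgraph := cart_prod (path_graph m) (path_graph n).

(* Main.v *)
(* A connected subgraph containing three vertices a, b, c of the grid crosses each
   unit step between their extreme rows and between their extreme columns, and an
   edge crosses only one such step; shortest paths from the coordinatewise median
   use exactly that many edges. Hence d({a,b,c}) is half the perimeter
   d(a,b) + d(b,c) + d(a,c) in the grid metric. Replacing 3-subsets by ordered
   triples (and removing those with coincidences), the index is a combination of
   the sums over vertices of d, of d^2 and of the squared transmission
   (sum_v d(u,v))^2, which reduce to the same sums on the two paths. *)
Require Import Defs.
From mathcomp Require Import all_boot all_order all_algebra.
From mathcomp Require Import zify ring lra.
Import GRing.Theory.

Set Implicit Arguments.
Unset Strict Implicit.
Unset Printing Implicit Defensive.

(** Subtraction is truncated, so one summand is always 0 and the sum is |i - j|. *)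
Definition natdist (i j : nat) : nat := (i - j) + (j - i).

Definition span3 (i j k : nat) : nat :=
  maxn i (maxn j k) - minn i (minn j k).

Lemma span3_natdist i j k :
  2 * span3 i j k = natdist i j + natdist j k + natdist i k.
Proof. by rewrite /span3 /natdist; lia. Qed.

(** * Growing and cutting connected subgraphs of an arbitrary graph *)

Section ConnectedSubgraphs.
Variable G : sgraph.
Implicit Types (x y u v a c : G) (S : {set G}) (K : {set G} * {set {set G}}).

Lemma set2_edgesE u v : ([set u; v] \in edges G) = adj u v.
Proof.
apply/idP/idP => [|uv]; last first.
  by rewrite inE; apply/existsP; exists u; apply/existsP; exists v; rewrite uv eqxx.
rewrite inE => /existsP[x /existsP[y /andP[xy /eqP E]]].
have [] : u \in [set x; y] /\ v \in [set x; y] by rewrite -E !inE !eqxx orbT.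
have [] : x \in [set u; v] /\ y \in [set u; v] by rewrite E !inE !eqxx orbT.
move: xy; rewrite !inE => xy /orP[]/eqP? /orP[]/eqP? /orP[]/eqP? /orP[]/eqP?; subst => //.
all: by rewrite adj_sym.
Qed.

(** Reachability from one root is easier to maintain than pairwise connectedness when a subgraph
    grows edge by edge. *)
Definition rooted c K : Prop :=
  [/\ is_subgraph K, c \in K.1 &
      forall x, x \in K.1 -> connect (fun u v : G => [set u; v] \in K.2) c x].

Lemma rooted_set1 c : rooted c ([set c], set0).
Proof.
split=> [||x]; rewrite ?set11 //=; last by rewrite inE => /eqP->.
by apply/forallP => f; rewrite inE.
Qed.

Lemma rooted_connects c K S : rooted c K -> S \subset K.1 -> connects S K.
Proof.
case=> sK cK cnK sS; apply/and3P; split => //; apply/andP; split.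
  by apply/set0Pn; exists c.
have sym : connect_sym (fun u v : G => [set u; v] \in K.2).
  by apply: sym_connect_sym => u v; rewrite setUC.
apply/forall_inP => x xK; apply/forall_inP => y yK.
by rewrite (connect_trans _ (cnK y yK)) // sym cnK.
Qed.

Lemma rooted_adj c K x y :
  rooted c K -> x \in K.1 -> adj x y ->
  rooted c (y |: K.1, [set x; y] |: K.2).
Proof.
case=> /forall_inP sK cK cnK xK xy.
have mono u v : connect (fun u v : G => [set u; v] \in K.2) u v ->
    connect (fun u v : G => [set u; v] \in [set x; y] |: K.2) u v.
  by apply: connect_sub => {}u {}v uv; apply: connect1; rewrite setU1r.
split=> [||z] /=; rewrite ?inE ?cK ?orbT //.
  apply/forall_inP => f /setU1P[->|/sK/andP[-> fK]] /=; last first.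
    exact: subset_trans fK (subsetUr _ _).
  rewrite set2_edgesE xy; apply/subsetP => z; rewrite !inE.
  by move=> /orP[]/eqP->; rewrite ?xK ?eqxx ?orbT.
case/orP=> [/eqP->|/cnK/mono //].
by apply: connect_trans (mono _ _ (cnK x xK)) (connect1 _); rewrite setU11.
Qed.

(** Walk from [x] along neighbours of decreasing [f], adding each edge to the subgraph. The walk can
    stop only at [a] and has at most [f x] steps. With [f] the distance to [a], this attaches a
    shortest path. *)
Lemma rooted_descend (f : G -> nat) a c K x :
    (forall u, u = a \/ exists2 v, adj u v & f v < f u) ->
    rooted c K -> x \in K.1 ->
  exists K', [/\ rooted c K', K.1 \subset K'.1, a \in K'.1 &
                 #|K'.2| <= #|K.2| + f x].
Proof.
move=> step; have [d] := ubnP (f x); elim: d => // d IH in K x *.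
move=> fx rK xK; have [xa|[y xy fy]] := step x.
  by exists K; split=> //; rewrite -?xa ?leq_addr.
have [||K' [rK' sK' aK' leK']] := IH (y |: K.1, [set x; y] |: K.2) y _ (rooted_adj rK xK xy).
- by lia.
- by rewrite setU11.
exists K'; split=> //; first exact: subset_trans (subsetUr _ _) sK'.
move: leK' => /=; rewrite cardsU1; case: (_ \notin _) => /=; lia.
Qed.

(** A discrete intermediate value argument: on a path of [K] from [x] to [y], take the first edge
    whose end has [p] above [i]. *)
Lemma connects_cross S K (p : G -> nat) x y i :
    connects S K -> x \in S -> y \in S -> p x <= i < p y ->
  exists u v, [/\ [set u; v] \in K.2, adj u v & p u <= i < p v].
Proof.
case/and3P=> /forall_inP sK /andP[_ /forall_inP cnK] /subsetP sS /sS xK /sS yK.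
have /forall_inP/(_ y yK)/connectP[q + ->] := cnK x xK.
elim: q x {xK yK} => [|z q IH] x /=; first by lia.
case/andP=> xz qP /andP[px py]; have [pz|pz] := leqP (p z) i.
  by apply: (IH z qP); rewrite pz py.
by exists x, z; rewrite -set2_edgesE px; split=> //; have /andP[] := sK _ xz.
Qed.

Lemma connects_cross3 a b c K (p : G -> nat) i :
    connects [set a; b; c] K ->
    minn (p a) (minn (p b) (p c)) <= i < maxn (p a) (maxn (p b) (p c)) ->
  exists u v, [/\ [set u; v] \in K.2, adj u v & p u <= i < p v].
Proof.
move=> cK /andP[li iu].
have [x xS px] : exists2 x, x \in [set a; b; c] & p x <= i.
  have [?|?] := leqP (p a) i; first by exists a; rewrite ?inE ?eqxx ?orbT.
  have [?|?] := leqP (p b) i; first by exists b; rewrite ?inE ?eqxx ?orbT.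
  by exists c; rewrite ?inE ?eqxx ?orbT //; lia.
have [y yS py] : exists2 y, y \in [set a; b; c] & i < p y.
  have [?|?] := ltnP i (p a); first by exists a; rewrite ?inE ?eqxx ?orbT.
  have [?|?] := ltnP i (p b); first by exists b; rewrite ?inE ?eqxx ?orbT.
  by exists c; rewrite ?inE ?eqxx ?orbT //; lia.
by apply: connects_cross cK xS yS _; rewrite px py.
Qed.

End ConnectedSubgraphs.

(** * The Steiner distance of three grid vertices *)

Section GridSteiner.
Variables m n : nat.
Local Notation G := (grid m n).
Implicit Types (u v a b c : G) (f : {set G}).

Definition grid_dist u v : nat := natdist u.1 v.1 + natdist u.2 v.2.

Lemma path_step k (i j : 'I_k) :
  i <> j -> exists2 l, path_adj i l & natdist l j < natdist i j.
Proof.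
move=> ij; have {ij} : (i : nat) <> j by move/val_inj.
move: (ltn_ord i) (ltn_ord j) => ik jk ij.
have [lt_ij|le_ji] := ltnP i j.
  have lk : i.+1 < k by lia.
  by exists (Ordinal lk); rewrite /path_adj ?eqxx //= /natdist; lia.
have lk : i.-1 < k by lia.
by exists (Ordinal lk); rewrite /path_adj /natdist /=; lia.
Qed.

Lemma grid_descend a u :
  u = a \/ exists2 v, adj u v & grid_dist v a < grid_dist u a.
Proof.
case: u a => [i j] [k l]; have [<-|/eqP ik] := eqVneq i k.
  have [<-|/eqP jl] := eqVneq j l; [by left | right].
  have [j' jj' lt] := path_step jl; exists (i, j').
    by rewrite /= /cart_adj /= eqxx /= jj'.
  by rewrite /grid_dist /=; lia.
right; have [i' ii' lt] := path_step ik; exists (i', j).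
  by rewrite /= /cart_adj /= eqxx /= ii' orbT.
by rewrite /grid_dist /=; lia.
Qed.

(** This makes the default candidate of the arg min in [steiner_dist] admissible, so that the value
    is a true minimum. A descent from [c] to [a] uses only edges of the grid, hence the grid is
    connected. *)
Lemma grid_connects (S : {set G}) : S != set0 -> connects S ([set: G], edges G).
Proof.
case/set0Pn=> c _; apply: (@rooted_connects _ c); last exact: subsetT.
split; rewrite ?inE //; first by apply/forall_inP => f ->; rewrite subsetT.
move=> a _; have cc : c \in ([set c], set0 : {set {set G}}).1 by rewrite set11.
have [K [[/forall_inP sK _ cnK] _ aK _]] :=
  rooted_descend (grid_descend a) (rooted_set1 c) cc.
apply: connect_sub (cnK a aK) => u v /sK/andP[uv _]; exact: connect1.
Qed.

(* An edge lying over the step [i, i+1] of a factor is sent to that factor and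
   [i]: its two endpoints have the odd sum [i + (i+1)] in this coordinate and an
   even sum in the other one. *)
Definition edge_step f : bool * nat :=
  let s := \sum_(u in f) (u.1 : nat) in
  if odd s then (true, s./2) else (false, (\sum_(u in f) (u.2 : nat))./2).

Lemma edge_step_set2 u v : u != v ->
  edge_step [set u; v] =
  if odd (u.1 + v.1) then (true, (u.1 + v.1)./2) else (false, (u.2 + v.2)./2).
Proof. by move=> uv; rewrite /edge_step !big_setU1 ?inE //= !big_set1. Qed.

(** [steps] lists without repetition the unit steps between the extreme rows and columns. Each is
    the image under [edge_step] of an edge of [K], so [K] has at least as many edges. *)
Lemma grid_steiner_lower a b c K : connects [set a; b; c] K ->
  span3 a.1 b.1 c.1 + span3 a.2 b.2 c.2 <= #|K.2|.
Proof.
move=> cK.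
pose steps (t : bool) i j k :=
  [seq (t, l) | l <- iota (minn i (minn j k)) (span3 i j k)].
have <- : size (steps true a.1 b.1 c.1 ++ steps false a.2 b.2 c.2) =
    span3 a.1 b.1 c.1 + span3 a.2 b.2 c.2.
  by rewrite size_cat !size_map !size_iota.
rewrite cardE -(size_map edge_step).
apply: uniq_leq_size.
  rewrite cat_uniq !map_inj_uniq ?iota_uniq /= ?andbT; try by move=> ? ? [].
  by apply/hasPn => _ /mapP[j _ ->]; apply/mapP => -[].
move=> s; rewrite mem_cat => /orP[]/mapP[i + ->{s}]; rewrite mem_iota => iP.
  have [|[u1 u2] [[v1 v2] [uvK uv /= uiv]]] := connects_cross3 (p := fun w : G => w.1 : nat) (i := i) cK.
    by move: iP; rewrite /span3; lia.
  apply/mapP; eexists; first by rewrite mem_enum; exact: uvK.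
  rewrite edge_step_set2; last by apply: contraTneq uiv => -[-> _]; rewrite ltnNge andbN.
  move: uv; rewrite /= /cart_adj /path_adj => /orP[/andP[/eqP/= E _]|/andP[+ _]].
    by move: uiv; rewrite E ltnNge andbN.
  (* Adjacency together with [u1 <= i < v1] forces [u1 = i] and [v1 = i + 1]. *)
  rewrite /= /path_adj => H; have -> : u1 + v1 = (i.*2).+1 by lia.
  by rewrite /= odd_double uphalf_double.
have [|[u1 u2] [[v1 v2] [uvK uv /= uiv]]] := connects_cross3 (p := fun w : G => w.2 : nat) (i := i) cK.
  by move: iP; rewrite /span3; lia.
apply/mapP; eexists; first by rewrite mem_enum; exact: uvK.
rewrite edge_step_set2; last by apply: contraTneq uiv => -[_ ->]; rewrite ltnNge andbN.
move: uv; rewrite /= /cart_adj /path_adj => /orP[/andP[/eqP/= -> +]|/andP[_ /eqP/= E]].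
  rewrite /= /path_adj => H; have -> : u2 + v2 = (i.*2).+1 by lia.
  by rewrite addnn odd_double /= uphalf_double.
by move: uiv; rewrite E ltnNge andbN.
Qed.

(** The witness is whichever of the three lies between the other two. *)
Lemma ord_median k (i j l : 'I_k) : exists h : 'I_k,
  natdist h i + natdist h j + natdist h l = span3 i j l.
Proof.
case/orP: (leq_total i j) => ij; case/orP: (leq_total j l) => jl;
  case/orP: (leq_total i l) => il;
  first [exists i; rewrite /span3 /natdist; lia | exists j; rewrite /span3 /natdist; lia
     | exists l; rewrite /span3 /natdist; lia].
Qed.

(* The lower bound is attained by the union of shortest paths from the
   coordinatewise median to the three vertices. *)
Lemma grid_steiner_upper a b c : exists2 K, connects [set a; b; c] K &
  #|K.2| <= span3 a.1 b.1 c.1 + span3 a.2 b.2 c.2.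
Proof.
have [h hE] := ord_median a.1 b.1 c.1; have [k kE] := ord_median a.2 b.2 c.2.
pose z : G := (h, k).
have z0 : z \in ([set z], set0 : {set {set G}}).1 by rewrite set11.
(* Each descent starts again at [z] inside the subgraph built so far, so the three edge counts add
   up to at most the sum of the distances from [z]. *)
have [K1 [r1 /subsetP s1 aK1 c1]] := rooted_descend (grid_descend a) (rooted_set1 z) z0.
have [K2 [r2 /subsetP s2 bK2 c2]] := rooted_descend (grid_descend b) r1 (s1 _ z0).
have [K3 [r3 /subsetP s3 cK3 c3]] := rooted_descend (grid_descend c) r2 (s2 _ (s1 _ z0)).
exists K3.
  apply: rooted_connects r3 _; apply/subsetP => w; rewrite !inE -orbA.
  by case/or3P=> /eqP-> //; apply: s3 => //; apply: s2.
rewrite -hE -kE; apply: leq_trans c3 _.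
apply: leq_trans (leq_add (leq_trans c2 (leq_add c1 (leqnn _))) (leqnn _)) _.
by rewrite cards0 /grid_dist /z /=; lia.
Qed.

Lemma steiner_dist_grid a b c :
  steiner_dist [set a; b; c] = span3 a.1 b.1 c.1 + span3 a.2 b.2 c.2.
Proof.
rewrite /steiner_dist; case: arg_minnP => [|K cK minK].
  by apply: grid_connects; apply/set0Pn; exists a; rewrite !inE eqxx.
have [K' cK' leK'] := grid_steiner_upper a b c.
by apply/eqP; rewrite eqn_leq grid_steiner_lower // (leq_trans (minK _ cK')).
Qed.

Lemma double_steiner_dist_grid a b c :
  2 * steiner_dist [set a; b; c] = grid_dist a b + grid_dist b c + grid_dist a c.
Proof. by rewrite steiner_dist_grid mulnDr !span3_natdist /grid_dist; lia. Qed.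

End GridSteiner.

Local Open Scope ring_scope.

(** * From sums over 3-subsets to sums over ordered triples *)

Section SumsOverSmallSets.
Variables (T : finType).

(** Double counting: a set of size [k.+1] with a marked element [x] is the same as a set of size [k]
    with a new element [x]. *)
Lemma sum_set_succ (k : nat) (g : {set T} -> rat) :
  \sum_(S : {set T} | #|S| == k.+1) k.+1%:R * g S =
  \sum_(S : {set T} | #|S| == k) \sum_(x | x \notin S) g (x |: S).
Proof.
transitivity (\sum_(S : {set T} | #|S| == k.+1) \sum_(x in S) g S).
  by apply: eq_bigr => S /eqP <-; rewrite sumr_const mulr_natl.
rewrite (exchange_big_dep xpredT) //= [RHS](exchange_big_dep xpredT) //=.
apply: eq_bigr => x _.
rewrite (reindex_onto (fun S => x |: S) (fun S => S :\ x)) /=; last first.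
  by move=> S /andP[_ xS]; rewrite setD1K.
apply: eq_bigl => S; rewrite setU11 andbT cardsU1.
have [xS|xS] := boolP (x \in S); last by rewrite setU1K ?eqxx ?andbT // add1n eqSS.
by rewrite !andbF; apply/negP => /andP[_ /eqP E]; move: xS; rewrite -E !inE eqxx.
Qed.

(* The subtracted sums run over the triples with a coincidence; the triples
   x, x, x are subtracted with a wrong multiplicity, but contribute 0. *)
Lemma sum_set3 (g : {set T} -> rat) (h : T -> T -> T -> rat) :
    (forall x y z, y != x -> z \notin [set x; y] -> g [set x; y; z] = h x y z) ->
    (forall x, h x x x = 0) ->
  6 * \sum_(S : {set T} | #|S| == 3) g S =
  \sum_x \sum_y \sum_z h x y z - \sum_x \sum_y (h x x y + h x y x + h x y y).
Proof.
move=> gE h0.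
have -> : 6 * \sum_(S : {set T} | #|S| == 3) g S =
    \sum_x \sum_(y | y != x) \sum_(z | z \notin [set x; y]) h x y z.
  (* The factor 6 = 2 * 3 is spent by [sum_set_succ] at sizes 3 and 2; at size 1 the factor is 1. *)
  transitivity (2 * \sum_(S : {set T} | #|S| == 3) 3%:R * g S).
    by rewrite -mulr_sumr mulrA; congr (_ * _).
  rewrite sum_set_succ mulr_sumr.
  rewrite (sum_set_succ 1 (fun S => \sum_(x | x \notin S) g (x |: S))).
  have := sum_set_succ 0 (fun S => \sum_(x | x \notin S)
     \sum_(x0 | x0 \notin (x |: S)) g (x0 |: (x |: S))).
  under eq_bigr do rewrite mul1r; move=> ->.
  rewrite (big_pred1 set0) => [|S /=]; last by rewrite cards_eq0.
  under eq_bigl do rewrite inE.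
  apply: eq_bigr => x _; under eq_bigl do rewrite setU0 inE.
  apply: eq_bigr => y yx; rewrite setU0 setUC.
  by apply: eq_bigr => z zxy; rewrite setUC gE.
rewrite -sumrB; apply: eq_bigr => x _; rewrite -sumrB.
(* Summed over [y], the terms [h x x y] cancel the inner sum at [y = x]. What else is left at
   [y = x] consists of copies of [h x x x], which vanish. *)
have -> : \sum_y (\sum_z h x y z - (h x x y + h x y x + h x y y)) =
    \sum_(y | y != x) (\sum_z h x y z - (h x y x + h x y y)).
  rewrite !sumrB; under [X in _ - X = _]eq_bigr do rewrite -addrA.
  rewrite [X in _ - X = _]big_split /= [X in X - _ = _](bigD1 x) //=.
  by rewrite [X in _ - (_ + X) = _](bigD1 x) //= !h0; ring.
apply: eq_bigr => y yx; rewrite [in RHS](bigID (fun z => z \in [set x; y])) /=.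
by rewrite big_setU1 ?inE 1?eq_sym //= big_set1; ring.
Qed.
End SumsOverSmallSets.

(** * Sums of perimeters of triples and of their squares *)

Section DistanceSums.
Variables (V : finType) (d : V -> V -> rat).

Definition dist_sum := \sum_x \sum_y d x y.
Definition dist_sq_sum := \sum_x \sum_y d x y ^+ 2.
Definition transmission_sq_sum := \sum_x (\sum_y d x y) ^+ 2.

Hypothesis d_sym : forall x y, d x y = d y x.

Let perimeter x y z := d x y + d y z + d x z.

Lemma sum_perimeter :
  \sum_x \sum_y \sum_z perimeter x y z = 3 * #|V|%:R * dist_sum.
Proof.
have -> : \sum_x \sum_y \sum_z perimeter x y z =
    \sum_x \sum_y \sum_(z : V) d x y + \sum_(x : V) \sum_y \sum_z d y z
    + \sum_x \sum_(y : V) \sum_z d x z.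
  do 3![rewrite -!big_split /=; apply: eq_bigr => ? _]; exact: erefl.
have -> : \sum_x \sum_y \sum_(z : V) d x y = #|V|%:R * dist_sum.
  rewrite mulr_sumr; apply: eq_bigr => x _; rewrite mulr_sumr.
  by apply: eq_bigr => y _; rewrite sumr_const mulr_natl.
have -> : \sum_(x : V) \sum_y \sum_z d y z = #|V|%:R * dist_sum.
  by rewrite sumr_const mulr_natl.
have -> : \sum_x \sum_(y : V) \sum_z d x z = #|V|%:R * dist_sum.
  by rewrite mulr_sumr; apply: eq_bigr => x _; rewrite sumr_const mulr_natl.
ring.
Qed.

(** Each of the three squares leaves one vertex free. Each of the three cross products involves two
    distances with a common vertex; fixing that vertex, the other two sum independently to a squared
    transmission. *)
Lemma sum_perimeter_sq :
  \sum_x \sum_y \sum_z perimeter x y z ^+ 2 =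
  3 * #|V|%:R * dist_sq_sum + 6 * transmission_sq_sum.
Proof.
have -> : \sum_x \sum_y \sum_z perimeter x y z ^+ 2 =
    \sum_x \sum_y \sum_(z : V) d x y ^+ 2 + \sum_(x : V) \sum_y \sum_z d y z ^+ 2
    + \sum_x \sum_(y : V) \sum_z d x z ^+ 2 +
    2 * (\sum_y \sum_x \sum_z d y x * d y z + \sum_x \sum_y \sum_z d x y * d x z
         + \sum_z \sum_x \sum_y d z x * d z y).
  rewrite [X in 2 * (X + _ + _)]exchange_big /=.
  rewrite [X in 2 * (_ + _ + X)]exchange_big /=.
  under [X in 2 * (_ + _ + X)]eq_bigr do rewrite exchange_big /=.
  rewrite !mulrDr !mulr_sumr -!big_split /=.
  apply: eq_bigr => x _; rewrite !mulr_sumr -!big_split /=.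
  apply: eq_bigr => y _; rewrite !mulr_sumr -!big_split /=.
  by apply: eq_bigr => z _; rewrite /perimeter (d_sym z x) (d_sym z y) (d_sym y x); ring.
have -> : \sum_x \sum_y \sum_(z : V) d x y ^+ 2 = #|V|%:R * dist_sq_sum.
  rewrite mulr_sumr; apply: eq_bigr => x _; rewrite mulr_sumr.
  by apply: eq_bigr => y _; rewrite sumr_const mulr_natl.
have -> : \sum_(x : V) \sum_y \sum_z d y z ^+ 2 = #|V|%:R * dist_sq_sum.
  by rewrite sumr_const mulr_natl.
have -> : \sum_x \sum_(y : V) \sum_z d x z ^+ 2 = #|V|%:R * dist_sq_sum.
  by rewrite mulr_sumr; apply: eq_bigr => x _; rewrite sumr_const mulr_natl.
(* With the common vertex outermost, the three cross sums coincide up to renaming, so this rewrites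
   all of them. *)
have -> : \sum_x \sum_y \sum_z d x y * d x z = transmission_sq_sum.
  apply: eq_bigr => x _; rewrite expr2 mulr_suml.
  by apply: eq_bigr => y _; rewrite mulr_sumr.
ring.
Qed.

End DistanceSums.

(** * Distance sums of a product with additive distance *)

Section ProductSums.
Variables A B : finType.

Lemma sum_prod_add (a : A -> rat) (b : B -> rat) :
  \sum_(u : A * B) (a u.1 + b u.2) =
  #|B|%:R * (\sum_i a i) + #|A|%:R * (\sum_j b j).
Proof.
rewrite -(pair_bigA _ (fun i j => a i + b j)) /=.
under eq_bigr do rewrite big_split sumr_const /=.
by rewrite big_split sumr_const /= sumrMnl !mulr_natl.
Qed.

Lemma sum_prod_mul (a : A -> rat) (b : B -> rat) :
  \sum_(u : A * B) a u.1 * b u.2 = (\sum_i a i) * (\sum_j b j).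
Proof.
rewrite -(pair_bigA _ (fun i j => a i * b j)) /= mulr_suml.
by apply: eq_bigr => i _; rewrite mulr_sumr.
Qed.

Lemma sum_prod_sq (a : A -> rat) (b : B -> rat) :
  \sum_(u : A * B) (a u.1 + b u.2) ^+ 2 =
  #|B|%:R * (\sum_i a i ^+ 2) + #|A|%:R * (\sum_j b j ^+ 2)
  + 2 * ((\sum_i a i) * (\sum_j b j)).
Proof.
rewrite -sum_prod_add -sum_prod_mul mulr_sumr -big_split /=.
by apply: eq_bigr => u _; ring.
Qed.

Variables (dA : A -> A -> rat) (dB : B -> B -> rat).
Let d (u v : A * B) := dA u.1 v.1 + dB u.2 v.2.

Lemma dist_sum_prod :
  dist_sum d = #|B|%:R ^+ 2 * dist_sum dA + #|A|%:R ^+ 2 * dist_sum dB.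
Proof.
rewrite /dist_sum; under eq_bigr do rewrite (sum_prod_add (dA _) (dB _)).
rewrite (sum_prod_add (fun i => #|B|%:R * \sum_k dA i k)
  (fun j => #|A|%:R * \sum_l dB j l)) -!mulr_sumr; ring.
Qed.

Lemma dist_sq_sum_prod :
  dist_sq_sum d = #|B|%:R ^+ 2 * dist_sq_sum dA + #|A|%:R ^+ 2 * dist_sq_sum dB
                  + 2 * (dist_sum dA * dist_sum dB).
Proof.
rewrite /dist_sq_sum; under eq_bigr do rewrite (sum_prod_sq (dA _) (dB _)).
rewrite big_split -mulr_sumr /=.
rewrite (sum_prod_add (fun i => #|B|%:R * \sum_k dA i k ^+ 2)
  (fun j => #|A|%:R * \sum_l dB j l ^+ 2)).
rewrite (sum_prod_mul (fun i => \sum_k dA i k) (fun j => \sum_l dB j l)).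
rewrite -!mulr_sumr /dist_sum; ring.
Qed.

(** The transmission of [(i, j)] is #|B| times that of [i] plus #|A| times that of [j], a sum with
    separated variables, to which [sum_prod_sq] applies. *)
Lemma transmission_sq_sum_prod :
  transmission_sq_sum d =
  #|B|%:R ^+ 3 * transmission_sq_sum dA + #|A|%:R ^+ 3 * transmission_sq_sum dB
  + 2 * #|A|%:R * #|B|%:R * (dist_sum dA * dist_sum dB).
Proof.
rewrite /transmission_sq_sum; under eq_bigr do rewrite (sum_prod_add (dA _) (dB _)).
rewrite (sum_prod_sq (fun i => #|B|%:R * \sum_k dA i k)
  (fun j => #|A|%:R * \sum_l dB j l)) -!mulr_sumr.
under eq_bigr do rewrite exprMn.
under [in X in _ + X + _]eq_bigr do rewrite exprMn.
rewrite -!mulr_sumr /dist_sum; ring.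
Qed.

End ProductSums.

(** * Distance sums of the path *)

Section PathSums.
Variable k : nat.

(** On a path both the transmission and, up to the factor [k], the sum of squared distances are
    monic quadratics in the position of the vertex. *)
Lemma sum_quadratic (b c : rat) : \sum_(j < k) (j%:R ^+ 2 + b * j%:R + c) =
  k%:R * (k%:R - 1) * (2 * k%:R - 1) / 6 + b * (k%:R * (k%:R - 1) / 2) + c * k%:R.
Proof.
elim: k => [|l IH]; first by rewrite big_ord0; ring.
by rewrite big_ord_recr /= IH -natr1; field.
Qed.

Lemma sum_quadratic_sq (b c : rat) :
  \sum_(j < k) (j%:R ^+ 2 + b * j%:R + c) ^+ 2 =
  k%:R * (k%:R - 1) * (2 * k%:R - 1) * (3 * k%:R ^+ 2 - 3 * k%:R - 1) / 30
  + 2 * b * (k%:R * (k%:R - 1) / 2) ^+ 2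
  + (b ^+ 2 + 2 * c) * (k%:R * (k%:R - 1) * (2 * k%:R - 1) / 6)
  + 2 * b * c * (k%:R * (k%:R - 1) / 2) + c ^+ 2 * k%:R.
Proof.
elim: k => [|l IH]; first by rewrite big_ord0; ring.
by rewrite big_ord_recr /= IH -natr1; field.
Qed.

Definition path_dist (i j : 'I_k) : rat := (natdist i j)%:R.

Lemma path_dist_sym i j : path_dist i j = path_dist j i.
Proof. by rewrite /path_dist /natdist addnC. Qed.

Lemma path_dist_sq i j : path_dist i j ^+ 2 = (i%:R - j%:R) ^+ 2.
Proof.
rewrite /path_dist /natdist; case: (leqP i j) => [ij|/ltnW ji].
  by rewrite (eqP ij) add0n natrB // -sqrrN opprB.
by rewrite (eqP ji) addn0 natrB.
Qed.

(** Induction on [j]: removing the first vertex of the path shifts [j] and all other positions down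
    by one. The value is j(j+1)/2 + (l-1-j)(l-j)/2, from the two sides of [j]. *)
Lemma sum_natdist l j : (j <= l)%N ->
  \sum_(i < l) (natdist j i)%:R =
  j%:R ^+ 2 + (1 - l%:R) * j%:R + l%:R * (l%:R - 1) / 2 :> rat.
Proof.
elim: j l => [|j IH] [|l] // jl.
- by rewrite big_ord0; field.
- elim: l {jl} => [|l IH]; first by rewrite big_ord_recl big_ord0 /natdist !subnn; field.
  by rewrite big_ord_recr /= IH /natdist sub0n subn0 add0n -!natr1; field.
rewrite big_ord_recl /= (eq_bigr (fun i : 'I_l => (natdist j i)%:R)); last first.
  by move=> i _; rewrite /natdist /bump /= !add1n !subSS.
by rewrite IH // /natdist subn0 sub0n addn0 -!natr1; field.
Qed.

Lemma path_transmission i :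
  \sum_j path_dist i j = i%:R ^+ 2 + (1 - k%:R) * i%:R + k%:R * (k%:R - 1) / 2.
Proof. by rewrite sum_natdist // ltnW. Qed.

Lemma path_dist_sum : dist_sum path_dist = (k%:R ^+ 3 - k%:R) / 3.
Proof.
by rewrite /dist_sum; under eq_bigr do rewrite path_transmission;
  rewrite sum_quadratic; field.
Qed.

Lemma path_dist_sq_sum :
  dist_sq_sum path_dist = k%:R ^+ 2 * (k%:R ^+ 2 - 1) / 6.
Proof.
rewrite /dist_sq_sum (eq_bigr (fun i : 'I_k =>
  k%:R * (i%:R ^+ 2 + (1 - k%:R) * i%:R + (k%:R - 1) * (2 * k%:R - 1) / 6))).
  by rewrite -mulr_sumr sum_quadratic; field.
move=> i _; rewrite (eq_bigr (fun j : 'I_k =>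
  j%:R ^+ 2 + (- 2 * i%:R) * j%:R + i%:R ^+ 2)).
  by rewrite sum_quadratic; field.
by move=> j _; rewrite path_dist_sq; ring.
Qed.

Lemma path_transmission_sq_sum : transmission_sq_sum path_dist =
  k%:R * (k%:R ^+ 2 - 1) * (7 * k%:R ^+ 2 - 8) / 60.
Proof.
by rewrite /transmission_sq_sum; under eq_bigr do rewrite path_transmission;
  rewrite sum_quadratic_sq; field.
Qed.

End PathSums.

(** * Assembling the index *)

Section TripleSum.
Variables (T : finType) (d : T -> T -> rat) (s : {set T} -> rat).
Hypotheses (d_sym : forall x y, d x y = d y x) (d_refl : forall x, d x x = 0).
Hypothesis s_perimeter :
  forall x y z, 2 * s [set x; y; z] = d x y + d y z + d x z.

Lemma sum_set3_perimeter :
  6 * (\sum_(S : {set T} | #|S| == 3) (s S + s S ^+ 2)) =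
  3 / 2 * #|T|%:R * dist_sum d + 3 / 4 * #|T|%:R * dist_sq_sum d
  + 3 / 2 * transmission_sq_sum d - 3 * dist_sum d - 3 * dist_sq_sum d.
Proof.
(* This is s + s^2 with s replaced by half the perimeter, which also makes sense for triples with
   coincidences. *)
pose h x y z := (d x y + d y z + d x z) / 2 + (d x y + d y z + d x z) ^+ 2 / 4.
rewrite (@sum_set3 _ _ h) => [|x y z _ _|x]; first last.
- by rewrite /h !d_refl; ring.
- by rewrite /h -s_perimeter; field.
have -> : \sum_x \sum_y \sum_z h x y z =
    (\sum_x \sum_y \sum_z (d x y + d y z + d x z)) / 2
    + (\sum_x \sum_y \sum_z (d x y + d y z + d x z) ^+ 2) / 4.
  rewrite !mulr_suml -big_split; apply: eq_bigr => x _ /=.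
  rewrite !mulr_suml -big_split; apply: eq_bigr => y _ /=.
  by rewrite !mulr_suml -big_split.
(* A triple with two equal entries has perimeter [2 * d x y], so each term is
   [d x y + d x y ^+ 2]. *)
have -> : \sum_x \sum_y (h x x y + h x y x + h x y y) =
    3 * (dist_sum d + dist_sq_sum d).
  rewrite -big_split mulr_sumr; apply: eq_bigr => x _ /=.
  rewrite -big_split mulr_sumr; apply: eq_bigr => y _ /=.
  by rewrite /h !d_refl (d_sym y x); field.
by rewrite sum_perimeter sum_perimeter_sq //; field.
Qed.

End TripleSum.

Lemma SWW3_grid (m n : nat) :
  SWW (grid m n) 3 =
    1 / 360 *
      (9 * m%:R ^+ 5 * n%:R ^+ 3 + 15 * m%:R ^+ 4 * n%:R ^+ 4
       + 9 * m%:R ^+ 3 * n%:R ^+ 5 + 15 * m%:R ^+ 4 * n%:R ^+ 3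
       + 15 * m%:R ^+ 3 * n%:R ^+ 4 - 30 * m%:R ^+ 4 * n%:R ^+ 2
       - 50 * m%:R ^+ 3 * n%:R ^+ 3 - 30 * m%:R ^+ 2 * n%:R ^+ 4
       + 26 * m%:R ^+ 3 * n%:R - 45 * m%:R ^+ 3 * n%:R ^+ 2
       - 45 * m%:R ^+ 2 * n%:R ^+ 3 + 45 * m%:R ^+ 2 * n%:R ^+ 2
       + 26 * m%:R * n%:R ^+ 3 + 30 * m%:R ^+ 2 * n%:R
       + 30 * m%:R * n%:R ^+ 2 - 20 * m%:R * n%:R) :> rat.
Proof.
pose d (u v : 'I_m * 'I_n) := path_dist u.1 v.1 + path_dist u.2 v.2.
have d_sym u v : d u v = d v u by rewrite /d !(path_dist_sym u.1) (path_dist_sym u.2).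
have d_refl u : d u u = 0 by rewrite /d /path_dist /natdist !subnn addr0.
have dE (u v : grid m n) : d u v = (grid_dist u v)%:R by rewrite natrD.
have s_per (a b c : grid m n) :
    2 * (steiner_dist [set a; b; c])%:R = d a b + d b c + d a c.
  by rewrite !dE -!natrD -double_steiner_dist_grid natrM.
have := @sum_set3_perimeter (grid m n) d (fun S => (steiner_dist S)%:R)
  d_sym d_refl s_per.
rewrite dist_sum_prod dist_sq_sum_prod transmission_sq_sum_prod.
rewrite !path_dist_sum !path_dist_sq_sum !path_transmission_sq_sum.
rewrite card_prod !card_ord natrM big_split /= => E.
(* The left side of [E] is twelve times the index; what remains is linear in the monomials in m and
   n. *)
rewrite /SWW -mulrDr; lra.
Qed.

Theorem theorem6p2 :
  (forall m n : nat, (3 <= m)%N -> (3 <= n)%N ->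
    SWW (grid m n) 3 =
    1 / 360 *
      (9 * m%:R ^+ 5 * n%:R ^+ 3 + 15 * m%:R ^+ 4 * n%:R ^+ 4
       + 9 * m%:R ^+ 3 * n%:R ^+ 5 + 15 * m%:R ^+ 4 * n%:R ^+ 3
       + 15 * m%:R ^+ 3 * n%:R ^+ 4 - 30 * m%:R ^+ 4 * n%:R ^+ 2
       - 50 * m%:R ^+ 3 * n%:R ^+ 3 - 30 * m%:R ^+ 2 * n%:R ^+ 4
       + 26 * m%:R ^+ 3 * n%:R - 45 * m%:R ^+ 3 * n%:R ^+ 2
       - 45 * m%:R ^+ 2 * n%:R ^+ 3 + 45 * m%:R ^+ 2 * n%:R ^+ 2
       + 26 * m%:R * n%:R ^+ 3 + 30 * m%:R ^+ 2 * n%:R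
       + 30 * m%:R * n%:R ^+ 2 - 20 * m%:R * n%:R) :> rat)
  /\
  (forall n : nat, (3 <= n)%N ->
    SWW (grid 2 n) 3 =
    1 / 15 *
      (3 * n%:R ^+ 5 + 10 * n%:R ^+ 4 - 25 * n%:R ^+ 2 + 12 * n%:R) :> rat).
Proof.
split=> [m n _ _|n _]; first exact: SWW3_grid.
(* At m = 2 the terms in n^3 cancel. *)
by rewrite SWW3_grid; field.
Qed.
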